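(* Let $f:\mathbb R\to\mathbb R$ be $C^2$ and strictly convex with $f(0)=f'(0)=0$ and $f''(0)\neq0$. Let $u_0<0<u_1$. For $\varepsilon\in(0,1]$ let $\hat u^\varepsilon$ be the unique solution of $$\varepsilon \hat u^\varepsilon_{xx}=(f(\hat u^\varepsilon))_x\ \ (0<x<1),\qquad \hat u^\varepsilon(0)=u_0,\quad \hat u^\varepsilon(1)=u_1 .$$ Let $v_0$ and $v_1$ be the unique solutions on $\mathbb R^+=[0,+\infty)$ of, respectively, $$v_0''=(f(v_0))',\quad v_0(0)=u_0,\quad v_0(+\infty)=0,\qquad\text{and}\qquad v_1''=-(f(v_1))',\quad v_1(0)=u_1,\quad v_1(+\infty)=0.$$ Then there is a constant $C>0$, independent of $\varepsilon\in(0,1]$, such that for all $x\in[0,1]$ $$\Big|\hat u^\varepsilon(x)-v_0\Big(\tfrac{x}{\varepsilon}\Big)-v_1\Big(\tfrac{1-x}{\varepsilon}\Big)\Big|\le C\varepsilon .$$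
   Context: For every $\varepsilon>0$ and $u_0,u_1\in\mathbb R$ the boundary value problem for $\hat u^\varepsilon$ has a unique solution. *)

(* Defs.v *)
From Stdlib Require Import Reals.
From Coquelicot Require Import Coquelicot.
Open Scope R_scope.

(* [Derive] is total, so differentiability of lower orders has to be
   requested explicitly. *)
Definition twice_derivable_on (D : R -> Prop) (u : R -> R) : Prop :=
  forall x, D x -> ex_derive u x /\ ex_derive_n u 2 x.

Definition C2 (f : R -> R) : Prop :=
  twice_derivable_on (fun _ => True) f /\
  forall x, continuous (Derive_n f 2) x.

Definition strictly_convex (f : R -> R) : Prop :=
  forall x y t, x <> y -> 0 < t < 1 ->
    f (t * x + (1 - t) * y) < t * f x + (1 - t) * f y.

(* In the three problems below only the values of the unknown on [0,1], resp.
   [0,+oo), matter: continuity is relative to that set, and the equation holds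
   in its interior.  For f in C^2 the equation makes the second derivative
   continuous there, so these are the usual classical solutions. *)
Definition viscous_solution (f : R -> R) (eps u0 u1 : R) (u : R -> R) : Prop :=
  continuous_on (fun x => 0 <= x <= 1) u /\
  twice_derivable_on (fun x => 0 < x < 1) u /\
  (forall x, 0 < x < 1 ->
     eps * Derive_n u 2 x = Derive (fun y => f (u y)) x) /\
  u 0 = u0 /\ u 1 = u1.

Definition left_layer_profile (f : R -> R) (u0 : R) (v : R -> R) : Prop :=
  continuous_on (fun x => 0 <= x) v /\
  twice_derivable_on (fun x => 0 < x) v /\
  (forall x, 0 < x -> Derive_n v 2 x = Derive (fun y => f (v y)) x) /\
  v 0 = u0 /\ is_lim v p_infty 0.

Definition right_layer_profile (f : R -> R) (u1 : R) (v : R -> R) : Prop :=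
  continuous_on (fun x => 0 <= x) v /\
  twice_derivable_on (fun x => 0 < x) v /\
  (forall x, 0 < x -> Derive_n v 2 x = - Derive (fun y => f (v y)) x) /\
  v 0 = u1 /\ is_lim v p_infty 0.

(* Main.v *)
Require Import Defs.
From Stdlib Require Import Reals Lra.
From Coquelicot Require Import Coquelicot.
Open Scope R_scope.

(** All three problems integrate once: [eps u' = f u + c], [v0' = f v0] and
    [v1' = - f v1]. The constant [c] is positive because [u] crosses the rest
    point 0, and crossing the unit interval with [f y >= m y^2] forces
    [c <= PI^2 eps^2 / m]. Let [s] be the zero of [u]. On [[0,s]] the rescaled
    [u] and [v0] are nonpositive, where [f] decreases, so they solve dissipative
    equations differing by the source [c]; over a time at most [1 / eps] they
    separate by at most [c / eps = O(eps)]. The same holds for [v1] on [[s,1]].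
    Finally both layers are [O(eps)] at [s], where [u] vanishes, hence by
    monotonicity each is [O(eps)] on the other's side. *)

(** * Extension by clamping, mean values, zeros and first integrals *)

(** The map [r] never increases distances, so a neighbourhood relative to [D] pulls back to a full
    one. Clamping to [[0,1]] or to the half-line thus extends solutions continuously to the whole
    line. *)
Lemma continuous_retract (D : R -> Prop) (u r : R -> R) :
  continuous_on D u -> (forall x, D (r x)) ->
  (forall x y, Rabs (r y - r x) <= Rabs (y - x)) ->
  forall x, continuous (fun y => u (r y)) x.
Proof.
  intros Hu Dr Lr x P HP.
  destruct (Hu (r x) (Dr x) P HP) as [d Hd].
  exists d; intros y Hy; apply Hd; [|apply Dr].
  apply Rle_lt_trans with (2 := Hy), Lr.
Qed.

(** Derivability is asked only inside, so that clamped functions, which may have corners at [a] and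
    [b], qualify. *)
Lemma mean_value (w dw : R -> R) (a b : R) :
  a < b -> (forall x, continuous w x) ->
  (forall x, a < x < b -> is_derive w x (dw x)) ->
  exists z, a < z < b /\ w b - w a = dw z * (b - a).
Proof.
  intros ab Hc Hd.
  assert (pr1 : forall z, a < z < b -> derivable_pt w z).
  { intros z Hz; apply ex_derive_Reals_0; eexists; now apply Hd. }
  assert (pr2 : forall z, a < z < b -> derivable_pt id z).
  { intros; apply derivable_pt_id. }
  destruct (MVT w id a b pr1 pr2 ab) as [z [Hz E]].
  - intros; apply continuity_pt_filterlim, Hc.
  - intros; apply derivable_continuous_pt, derivable_pt_id.
  - exists z; split; [exact Hz|].
    rewrite (pr_nu id z _ (derivable_pt_id z)), derive_pt_id in E.
    rewrite Derive_Reals, (is_derive_unique _ _ _ (Hd z Hz)) in E.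
    unfold id in E; lra.
Qed.

(** Take the supremum of the points where [w] is nonpositive: beyond it [w] is positive by
    definition, and continuity excludes either sign at the supremum itself. *)
Lemma last_zero (w : R -> R) (a b : R) :
  (forall x, continuous w x) -> a < b -> w a < 0 -> 0 < w b ->
  exists s, a < s < b /\ w s = 0 /\ forall y, s < y <= b -> 0 < w y.
Proof.
  intros Hc ab wa wb.
  assert (near : forall x e, 0 < e -> exists d, 0 < d /\
            forall y, Rabs (y - x) < d -> Rabs (w y - w x) < e).
  { intros x e He.
    destruct (proj1 (filterlim_locally w (w x)) (Hc x) (mkposreal e He)) as [d Hd].
    exists d; split; [apply cond_pos|]; intros y Hy; exact (Hd y Hy). }
  destruct (completeness (fun x => a <= x <= b /\ w x <= 0)) as [s [ub lub]].
  - exists b; intros x [H _]; lra.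
  - exists a; lra.
  - assert (as_ : a <= s) by (apply ub; lra).
    assert (sb : s <= b) by (apply lub; intros x [H _]; lra).
    assert (pos : forall y, s < y <= b -> 0 < w y).
    { intros y Hy; destruct (Rlt_le_dec 0 (w y)) as [H|H]; [exact H|].
      assert (y <= s) by (apply ub; lra); lra. }
    assert (ws : w s = 0).
    { destruct (Rtotal_order (w s) 0) as [H|[H|H]]; [|exact H|].
      - destruct (near s (- w s)) as [d [Hd Hn]]; [lra|].
        assert (s <> b) by (intros ->; lra).
        pose proof (Rmin_l b (s + d / 2)); pose proof (Rmin_r b (s + d / 2)).
        assert (s < Rmin b (s + d / 2)) by (apply Rmin_glb_lt; lra).
        set (y := Rmin b (s + d / 2)) in *.
        assert (P : 0 < w y) by (apply pos; lra).
        assert (N : Rabs (w y - w s) < - w s)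
          by (apply Hn; rewrite Rabs_right; lra).
        apply Rabs_def2 in N; lra.
      - destruct (near s (w s) H) as [d [Hd Hn]].
        assert (s <= s - d / 2); [|lra].
        apply lub; intros x [Hx wx].
        destruct (Rle_lt_dec x (s - d / 2)) as [L|L]; [exact L|].
        assert (x <= s) by (apply ub; lra).
        assert (N : Rabs (w x - w s) < w s)
          by (apply Hn; rewrite Rabs_left1; lra).
        apply Rabs_def2 in N; lra. }
    exists s; repeat split; trivial.
    + destruct as_ as [H|H]; [exact H|rewrite <- H in ws; lra].
    + destruct sb as [H|H]; [exact H|rewrite H in ws; lra].
Qed.

(** The difference [eps * u' - F u] has zero derivative, and [D] is an interval, so it is constant;
    [a] is only a base point. *)
Lemma first_integral (D : R -> Prop) (F u : R -> R) (eps a : R) :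
  (forall x y z, D x -> D z -> x <= y <= z -> D y) -> D a ->
  twice_derivable_on D u -> (forall y, ex_derive F y) ->
  (forall x, D x -> eps * Derive_n u 2 x = Derive (fun y => F (u y)) x) ->
  exists c, forall x, D x -> eps * Derive u x = F (u x) + c.
Proof.
  intros Dc Da Hu HF E.
  set (h := fun x => eps * Derive u x - F (u x)).
  assert (Hh : forall x, D x -> is_derive h x 0).
  { intros x Dx; destruct (Hu x Dx) as [Ex1 Ex2].
    assert (HFu : ex_derive (fun y => F (u y)) x) by now apply ex_derive_comp.
    replace 0 with (minus (eps * Derive_n u 2 x) (Derive (fun y => F (u y)) x)).
    - apply (is_derive_minus (fun x => eps * Derive u x)); [|now apply Derive_correct].
      apply (is_derive_scal (Derive u)); exact (Derive_correct _ _ Ex2).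
    - rewrite E by exact Dx; apply Rminus_diag. }
  assert (K : forall x y, D x -> D y -> x <= y -> h x = h y).
  { intros x y Dx Dy [L| ->]; [|reflexivity].
    destruct (MVT_gen h x y (fun _ => 0)) as [z [_ Hz]].
    - rewrite Rmin_left, Rmax_right by lra.
      intros z Hz; apply Hh, (Dc x z y); trivial; lra.
    - rewrite Rmin_left, Rmax_right by lra.
      intros z Hz; apply continuity_pt_filterlim, (ex_derive_continuous h).
      eexists; apply Hh, (Dc x z y); trivial; lra.
    - lra. }
  exists (h a); intros x Dx.
  enough (h x = h a) by (unfold h in *; lra).
  destruct (Rle_lt_dec x a); [now apply K|symmetry; apply K; trivial; lra].
Qed.

(** * The convex flux, and bounds on the flux constant *)

Section Convex.

Variable f : R -> R.
Hypothesis f_C2 : C2 f.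
Hypothesis f_convex : strictly_convex f.
Hypothesis f_0 : f 0 = 0.
Hypothesis df_0 : Derive f 0 = 0.

Lemma flux_derive (y : R) : is_derive f y (Derive f y).
Proof. apply Derive_correct; now apply (proj1 f_C2). Qed.

Lemma flux_continuous (y : R) : continuous f y.
Proof. apply (ex_derive_continuous f); eexists; apply flux_derive. Qed.

Lemma flux_star (y t : R) : 0 <= t <= 1 -> f (t * y) <= t * f y.
Proof.
  intros Ht.
  destruct (Req_dec y 0) as [->|Hy]; [rewrite Rmult_0_r, f_0; lra|].
  destruct (Req_dec t 0) as [->|H0]; [rewrite !Rmult_0_l, f_0; lra|].
  destruct (Req_dec t 1) as [->|H1]; [rewrite !Rmult_1_l; lra|].
  assert (H := f_convex y 0 t Hy ltac:(lra)).
  rewrite f_0, !Rmult_0_r, !Rplus_0_r in H; lra.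
Qed.

(** If [f y < 0], convexity keeps the quotient [f (t * y) / t] below [f y] for small positive [t],
    although it tends to [y * f'(0) = 0]. *)
Lemma flux_ge0 (y : R) : 0 <= f y.
Proof.
  destruct (Rle_lt_dec 0 (f y)) as [H|H]; [exact H|exfalso].
  assert (D : is_derive (fun t => f (t * y)) 0 0).
  { evar_last.
    - apply (is_derive_comp f (fun t => t * y) 0 (Derive f (0 * y)) y).
      + apply flux_derive.
      + auto_derive; [trivial|ring].
    - rewrite Rmult_0_l, df_0; apply Rmult_0_r. }
  apply is_derive_Reals in D.
  destruct (D (- f y / 2)) as [d Hd]; [lra|].
  pose proof (cond_pos d) as dp.
  set (t := Rmin 1 (d / 2)).
  assert (tp : 0 < t) by (apply Rmin_glb_lt; lra).
  assert (t1 : t <= 1) by apply Rmin_l.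
  assert (t2 : t <= d / 2) by apply Rmin_r.
  assert (N := Hd t ltac:(lra) ltac:(rewrite Rabs_right; lra)).
  rewrite Rplus_0_l, Rmult_0_l, f_0, !Rminus_0_r in N.
  apply Rabs_def2 in N.
  assert (S := flux_star y t ltac:(lra)).
  assert (f (t * y) / t <= f y)
    by (apply Rle_div_l; [exact tp|lra]).
  lra.
Qed.

Lemma flux_gt0 (y : R) : y <> 0 -> 0 < f y.
Proof.
  intros Hy.
  assert (H := f_convex y 0 (/ 2) Hy ltac:(lra)).
  rewrite f_0 in H.
  pose proof (flux_ge0 (/ 2 * y + (1 - / 2) * 0)); lra.
Qed.

(** Monotonicity of [f] along each ray from 0; the next two lemmas read it off on either
    half-line. *)
Lemma flux_scaled_le (t y : R) : 0 <= t <= 1 -> f (t * y) <= f y.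
Proof.
  intros Ht; pose proof (flux_star y t Ht); pose proof (flux_ge0 y); nra.
Qed.

Lemma flux_incr (x y : R) : 0 <= x <= y -> f x <= f y.
Proof.
  intros H; destruct (Req_dec y 0) as [->|Hy].
  - replace x with 0 by lra; lra.
  - replace x with (x / y * y) by (field; lra).
    apply flux_scaled_le; split.
    + apply Rdiv_le_0_compat; lra.
    + apply Rle_div_l; lra.
Qed.

Lemma flux_decr (x y : R) : x <= y <= 0 -> f y <= f x.
Proof.
  intros H; destruct (Req_dec x 0) as [->|Hx].
  - replace y with 0 by lra; lra.
  - replace y with (- y / - x * x) by (field; lra).
    apply flux_scaled_le; split.
    + apply Rdiv_le_0_compat; lra.
    + apply Rle_div_l; lra.
Qed.

(** Near 0 the bound comes from [f''(0) > 0]; farther out [f] is at least a positive constant by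
    monotonicity, while [y ^ 2] is at most [B ^ 2]. *)
Lemma flux_quadratic (B : R) : Derive_n f 2 0 <> 0 -> 0 < B ->
  exists m, 0 < m /\ forall y, Rabs y <= B -> m * y ^ 2 <= f y.
Proof.
  intros d2 HB.
  set (D := Derive_n f 2 0) in *.
  assert (DD : is_derive (Derive f) 0 D)
    by (apply Derive_correct; now apply (proj1 f_C2)).
  apply is_derive_Reals in DD.
  destruct (DD (Rabs D / 2)) as [d Hd].
  { assert (0 < Rabs D) by now apply Rabs_pos_lt. lra. }
  pose proof (cond_pos d) as dp.
  assert (near : forall z, z <> 0 -> Rabs z < d -> Rabs (Derive f z / z - D) < Rabs D / 2).
  { intros z Hz Az; generalize (Hd z Hz Az).
    now rewrite Rplus_0_l, df_0, Rminus_0_r. }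
  assert (mv : forall a b, a < b -> exists z, a < z < b /\ f b - f a = Derive f z * (b - a)).
  { intros; apply mean_value; trivial.
    - apply flux_continuous.
    - intros; apply flux_derive. }
  (* A negative [D] would make [f'] negative just right of 0, hence [f (d / 2) < 0]. *)
  assert (Dpos : 0 < D).
  { destruct (Rtotal_order D 0) as [H|[H|H]]; [exfalso|contradiction|exact H].
    destruct (mv 0 (d / 2)) as [z [Hz E]]; [lra|].
    assert (N := near z ltac:(lra) ltac:(rewrite Rabs_right; lra)).
    rewrite (Rabs_left D) in N by exact H; apply Rabs_def2 in N.
    assert (Derive f z / z * z < 0) by nra.
    replace (Derive f z / z * z) with (Derive f z) in * by (field; lra).
    pose proof (flux_ge0 (d / 2)); nra. }
  rewrite (Rabs_right D) in near by lra.
  (* For [0 < |z| < d], [f' z / z] exceeds [D / 2], so [f y - D / 4 * y ^ 2] decreases left of 0 and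
     increases right of it, starting from the value 0. *)
  assert (core : forall y, Rabs y < d -> D / 4 * y ^ 2 <= f y).
  { assert (mvq : forall a b, a < b -> exists z, a < z < b /\
        (f b - D / 4 * b ^ 2) - (f a - D / 4 * a ^ 2) = (Derive f z - D / 2 * z) * (b - a)).
    { intros a b ab.
      apply (mean_value (fun y => f y - D / 4 * y ^ 2) (fun z => Derive f z - D / 2 * z)); trivial.
      - intros x; apply (ex_derive_continuous (fun y => f y - D / 4 * y ^ 2)).
        auto_derive; now apply (proj1 f_C2).
      - intros x _; auto_derive; [now apply (proj1 f_C2)|].
        change (fun y => f y) with f; field. }
    intros y Ay.
    destruct (Rtotal_order y 0) as [H|[->|H]].
    - destruct (mvq y 0 H) as [z [Hz E]].
      rewrite Rabs_left in Ay by exact H.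
      assert (N := near z ltac:(lra) ltac:(rewrite Rabs_left; lra)).
      apply Rabs_def2 in N; rewrite f_0 in E.
      assert (Derive f z / z * z <= D / 2 * z) by nra.
      replace (Derive f z / z * z) with (Derive f z) in * by (field; lra).
      nra.
    - rewrite f_0; lra.
    - destruct (mvq 0 y H) as [z [Hz E]].
      rewrite Rabs_right in Ay by lra.
      assert (N := near z ltac:(lra) ltac:(rewrite Rabs_right; lra)).
      apply Rabs_def2 in N; rewrite f_0 in E.
      assert (D / 2 * z <= Derive f z / z * z) by nra.
      replace (Derive f z / z * z) with (Derive f z) in * by (field; lra).
      nra. }
  set (p := Rmin (f (d / 2)) (f (- (d / 2)))).
  assert (pp : 0 < p) by (apply Rmin_glb_lt; apply flux_gt0; lra).
  assert (p1 : p <= f (d / 2)) by apply Rmin_l.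
  assert (p2 : p <= f (- (d / 2))) by apply Rmin_r.
  (* The first entry serves [|y| < d], the second [d <= |y| <= B]. *)
  set (m := Rmin (D / 4) (p / B ^ 2)).
  assert (B2 : 0 < B ^ 2) by nra.
  assert (m1 : m <= D / 4) by apply Rmin_l.
  assert (m2 : m * B ^ 2 <= p).
  { apply Rle_div_r; [exact B2|apply Rmin_r]. }
  assert (mp : 0 < m).
  { apply Rmin_glb_lt; [lra|now apply Rdiv_lt_0_compat]. }
  exists m; split; [exact mp|]; intros y Hy.
  destruct (Rlt_le_dec (Rabs y) d) as [H|H].
  - apply Rle_trans with (2 := core y H); nra.
  - assert (y ^ 2 <= B ^ 2) by (rewrite <- (pow2_abs y); pose proof (Rabs_pos y); nra).
    apply Rle_trans with p; [nra|].
    unfold Rabs in H; destruct (Rcase_abs y).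
    + apply Rle_trans with (1 := p2), flux_decr; lra.
    + apply Rle_trans with (1 := p1), flux_incr; lra.
Qed.

(* For a nonpositive flux constant, 0 would be an upper barrier: past its last
   zero [u] satisfies [eps u' <= f 1 * u] and Gronwall keeps it nonpositive. *)
Lemma flux_constant_pos (u : R -> R) (eps c s : R) :
  0 < eps -> (forall x, continuous u x) ->
  (forall x, 0 < x < 1 -> is_derive u x ((f (u x) + c) / eps)) ->
  0 < s < 1 -> u s = 0 -> (forall y, s < y <= 1 -> 0 < u y) -> 0 < c.
Proof.
  intros He uc ud Hs us up.
  destruct (Rlt_le_dec 0 c) as [H|H]; [exact H|exfalso].
  destruct (proj1 (filterlim_locally u (u s)) (uc s) (mkposreal 1 Rlt_0_1)) as [d Hd].
  pose proof (cond_pos d) as dp.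
  (* Close enough to [s] that [0 < u < 1] on the open interval from [s] to [y]; there convexity
     gives [f u <= u * f 1]. *)
  set (y := Rmin 1 (s + d / 2)).
  assert (sy : s < y) by (apply Rmin_glb_lt; lra).
  assert (y1 : y <= 1) by apply Rmin_l.
  assert (y2 : y <= s + d / 2) by apply Rmin_r.
  set (k := f 1 / eps).
  destruct (mean_value (fun x => u x * exp (- k * x))
    (fun x => ((f (u x) + c) / eps - k * u x) * exp (- k * x)) s y sy) as [z [Hz E]].
  - intros x; apply (continuous_mult u (fun x => exp (- k * x))); [apply uc|].
    apply (ex_derive_continuous (fun x => exp (- k * x))); auto_derive; trivial.
  - intros x Hx.
    assert (D := ud x ltac:(lra)).
    auto_derive; [now exists ((f (u x) + c) / eps)|].
    change (fun x => u x) with u; rewrite (is_derive_unique _ _ _ D); ring.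
  - assert (uz : 0 < u z) by (apply up; lra).
    assert (uz1 : u z < 1).
    { assert (N : Rabs (u z - u s) < 1).
      { apply (Hd z); change (Rabs (z - s) < d); rewrite Rabs_right; lra. }
      apply Rabs_def2 in N; lra. }
    assert (S := flux_star 1 (u z) ltac:(lra)); rewrite Rmult_1_r in S.
    assert (A : (f (u z) + c) / eps - k * u z <= 0).
    { replace ((f (u z) + c) / eps - k * u z) with (- ((u z * f 1 - f (u z) - c) / eps))
        by (unfold k; field; lra).
      assert (0 <= (u z * f 1 - f (u z) - c) / eps)
        by (apply Rdiv_le_0_compat; lra).
      lra. }
    assert (uy : 0 < u y) by (apply up; lra).
    (* The weighted function vanishes at [s] and is positive at [y], yet its slope at [z] is
       nonpositive. *)
    rewrite us in E.
    pose proof (exp_pos (- k * z)); pose proof (exp_pos (- k * y)).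
    assert (0 < u y * exp (- k * y)) by nra.
    assert (((f (u z) + c) / eps - k * u z) * exp (- k * z) <= 0) by nra.
    nra.
Qed.

(* Since [eps u' >= m u^2 + c], the angle [atan (sqrt (m/c) u)] grows at speed
   at least [sqrt (m c) / eps], while it cannot grow by more than [PI]. *)
Lemma flux_constant_le (u : R -> R) (eps c m : R) :
  0 < eps -> 0 < c -> 0 < m -> (forall x, continuous u x) ->
  (forall x, 0 < x < 1 -> is_derive u x ((f (u x) + c) / eps)) ->
  (forall x, 0 < x < 1 -> m * u x ^ 2 <= f (u x)) ->
  m * c <= PI ^ 2 * eps ^ 2.
Proof.
  intros He Hc Hm uc ud uq.
  set (s := sqrt (m / c)).
  assert (mc : 0 < m / c) by now apply Rdiv_lt_0_compat.
  assert (sp : 0 < s) by now apply sqrt_lt_R0.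
  assert (s2 : s * s = m / c) by (apply sqrt_sqrt; lra).
  destruct (mean_value (fun x => atan (s * u x))
    (fun x => s * ((f (u x) + c) / eps) / (1 + s * s * u x ^ 2)) 0 1) as [z [Hz E]].
  - lra.
  - intros x; apply (continuous_comp (fun x => s * u x) atan).
    + apply (continuous_scal_r s u), uc.
    + apply (ex_derive_continuous atan); auto_derive; trivial.
  - intros x Hx; assert (D := ud x Hx).
    auto_derive; [now exists ((f (u x) + c) / eps)|].
    change (fun x => u x) with u; rewrite (is_derive_unique _ _ _ D).
    field; split; [lra|]; pose proof (pow2_ge_0 (s * u x)); nra.
  - assert (Q := uq z Hz).
    (* As [s * s = m / c], the numerator bound [m * u^2 + c] equals [c] times the denominator, which
       cancels. *)
    assert (G : s * c / eps <= s * ((f (u z) + c) / eps) / (1 + s * s * u z ^ 2)).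
    { assert (den : 1 + s * s * u z ^ 2 > 0) by (pose proof (pow2_ge_0 (s * u z)); nra).
      apply (proj1 (Rle_div_r _ _ _ den)).
      replace (s * c / eps * (1 + s * s * u z ^ 2)) with (s * ((m * u z ^ 2 + c) / eps))
        by (rewrite s2; field; lra).
      apply Rmult_le_compat_l; [lra|].
      apply Rmult_le_compat_r; [|lra].
      left; now apply Rinv_0_lt_compat. }
    pose proof (atan_bound (s * u 1)); pose proof (atan_bound (s * u 0)).
    assert (L : s * c / eps <= PI) by lra.
    apply (Rle_div_l _ _ _ He) in L.
    replace (m * c) with ((s * c) * (s * c)).
    + assert (0 < s * c) by nra. nra.
    + replace (s * c * (s * c)) with (s * s * (c * c)) by ring.
      rewrite s2; field; lra.
Qed.

End Convex.

(** * Comparison for dissipative equations *)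

(* The difference [w = p - q] satisfies [w w' <= |k| |w|], so the regularised
   modulus [sqrt (w^2 + d^2)] has slope at most [|k|]. *)
Lemma dissipative_comparison (F p q : R -> R) (k b : R) :
  0 <= b -> (forall x, continuous p x) -> (forall x, continuous q x) ->
  (forall x, 0 < x < b -> is_derive p x (F (p x) + k)) ->
  (forall x, 0 < x < b -> is_derive q x (F (q x))) ->
  (forall x, 0 < x < b -> (p x - q x) * (F (p x) - F (q x)) <= 0) ->
  p 0 = q 0 -> Rabs (p b - q b) <= Rabs k * b.
Proof.
  intros Hb pc qc pd qd diss E0.
  destruct Hb as [Hb|<-]; [|rewrite E0, Rminus_diag, Rabs_R0; lra].
  (* The parameter [d] keeps [g] differentiable where [p = q]; since [g 0 = d], it is also the slack
     left in the bound. *)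
  apply le_epsilon; intros d Hd.
  set (g := fun x => sqrt ((p x - q x) ^ 2 + d ^ 2)).
  assert (arg : forall x, 0 < (p x - q x) ^ 2 + d ^ 2).
  { intros x; pose proof (pow2_ge_0 (p x - q x)); pose proof (pow_lt d 2 Hd); lra. }
  assert (gp : forall x, 0 < g x) by (intros; apply sqrt_lt_R0, arg).
  assert (gw : forall x, Rabs (p x - q x) <= g x).
  { intros x; rewrite <- sqrt_Rsqr_abs; apply sqrt_le_1_alt; unfold Rsqr; nra. }
  destruct (mean_value g
    (fun x => (p x - q x) * (F (p x) + k - F (q x)) / g x) 0 b Hb) as [z [Hz E]].
  - intros x; apply (continuous_comp (fun x => (p x - q x) ^ 2 + d ^ 2) sqrt).
    + apply (continuous_plus (fun x => (p x - q x) ^ 2)); [|apply continuous_const].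
      apply (continuous_comp (fun x => p x - q x) (fun t => t ^ 2)).
      * apply (continuous_minus p q); [apply pc|apply qc].
      * apply (ex_derive_continuous (fun t => t ^ 2)); auto_derive; trivial.
    + apply continuity_pt_filterlim, continuity_pt_sqrt.
      left; apply arg.
  - intros x Hx.
    assert (P := pd x Hx); assert (Q := qd x Hx).
    pose proof (gp x) as gx; pose proof (arg x) as ax.
    unfold g in *; auto_derive.
    + repeat split; [eexists; exact P|eexists; exact Q|simpl in *; lra].
    + change (fun x => p x) with p; change (fun x => q x) with q.
      rewrite (is_derive_unique _ _ _ P), (is_derive_unique _ _ _ Q).
      replace ((p x + - q x) * ((p x + - q x) * 1) + d * (d * 1))
        with ((p x - q x) ^ 2 + d ^ 2) by ring.
      field; lra.
  - assert (W := diss z Hz).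
    assert (K : k * (p z - q z) <= Rabs k * g z).
    { apply Rle_trans with (1 := Rle_abs _); rewrite Rabs_mult.
      apply Rmult_le_compat_l; [apply Rabs_pos|apply gw]. }
    assert (S : (p z - q z) * (F (p z) + k - F (q z)) / g z <= Rabs k).
    { apply Rle_div_l; [apply gp|]. lra. }
    assert (g0 : g 0 = d).
    { unfold g; rewrite E0, Rminus_diag.
      replace (0 ^ 2 + d ^ 2) with (Rsqr d) by (unfold Rsqr; ring).
      apply sqrt_Rsqr; lra. }
    apply Rle_trans with (1 := gw b); nra.
Qed.

(** * First-order equations for the profiles and the viscous solution *)

(* [v (x + 1) - v x = v' z] tends to 0 while [v'] tends to the constant of
   the first integral, which therefore vanishes. *)
Lemma profile_ode (F v : R -> R) :
  (forall y, ex_derive F y) -> F 0 = 0 ->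
  continuous_on (fun x => 0 <= x) v ->
  twice_derivable_on (fun x => 0 < x) v ->
  (forall x, 0 < x -> Derive_n v 2 x = Derive (fun y => F (v y)) x) ->
  is_lim v p_infty 0 ->
  exists w, (forall x, 0 <= x -> w x = v x) /\ (forall x, continuous w x) /\
    (forall x, 0 < x -> is_derive w x (F (w x))) /\ is_lim w p_infty 0.
Proof.
  intros HF F0 vc vd E lim.
  destruct (first_integral (fun x => 0 < x) F v 1 1) as [c Hc]; trivial.
  - intros; lra.
  - lra.
  - intros x Hx; rewrite Rmult_1_l; now apply E.
  - set (w := fun x => v (Rmax 0 x)).
    assert (wv : forall x, 0 <= x -> w x = v x).
    { intros x Hx; unfold w; now rewrite Rmax_right. }
    assert (wc : forall x, continuous w x).
    { apply (continuous_retract (fun x => 0 <= x) v (Rmax 0)); trivial.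
      - intros; apply Rmax_l.
      - intros x y; unfold Rmax; destruct (Rle_dec 0 x), (Rle_dec 0 y);
          unfold Rabs; repeat destruct Rcase_abs; lra. }
    assert (wd : forall x, 0 < x -> is_derive w x (F (w x) + c)).
    { intros x Hx; rewrite wv, <- Hc by lra; rewrite Rmult_1_l.
      apply is_derive_ext_loc with v.
      - exists (mkposreal x Hx); intros y Hy.
        change (Rabs (y - x) < x) in Hy; apply Rabs_def2 in Hy.
        symmetry; apply wv; lra.
      - apply Derive_correct; now apply vd. }
    assert (wl : is_lim w p_infty 0).
    { apply is_lim_ext_loc with v; [|exact lim].
      exists 0; intros x Hx; symmetry; apply wv; lra. }
    assert (c0 : c = 0).
    { apply cond_eq; intros e He.
      assert (Fl : is_lim (fun x => F (w x)) p_infty 0).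
      { replace (Finite 0) with (Finite (F 0)) by now rewrite F0.
        apply (is_lim_comp_continuous w F p_infty 0); [exact wl|].
        apply (ex_derive_continuous F), HF. }
      apply is_lim_spec in wl; apply is_lim_spec in Fl.
      assert (e4 : 0 < e / 4) by lra.
      destruct (wl (mkposreal _ e4)) as [M1 H1].
      destruct (Fl (mkposreal _ e4)) as [M2 H2].
      simpl in H1, H2.
      (* Beyond [M], both [w] and [F w] are within [e / 4] of 0, so [c = w (M + 1) - w M - F (w z)]
         is below [3 * e / 4] in modulus. *)
      set (M := Rmax 0 (Rmax M1 M2) + 1).
      assert (0 < M /\ M1 < M /\ M2 < M) as [M0 [MM1 MM2]].
      { pose proof (Rmax_l 0 (Rmax M1 M2)); pose proof (Rmax_r 0 (Rmax M1 M2)).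
        pose proof (Rmax_l M1 M2); pose proof (Rmax_r M1 M2).
        unfold M; lra. }
      destruct (mean_value w (fun x => F (w x) + c) M (M + 1)) as [z [Hz Ez]];
        [lra|exact wc|intros; apply wd; lra|].
      assert (A := H1 M ltac:(lra)); assert (B := H1 (M + 1) ltac:(lra)).
      assert (G := H2 z ltac:(lra)).
      apply Rabs_def2 in A; apply Rabs_def2 in B; apply Rabs_def2 in G.
      apply Rabs_def1; lra. }
    exists w; split; [exact wv|split; [exact wc|split; [|exact wl]]].
    intros x Hx; rewrite <- (Rplus_0_r (F (w x))), <- c0; now apply wd.
Qed.

Lemma derive_ge0_incr (w dw : R -> R) (x y : R) :
  (forall x, continuous w x) -> x <= y ->
  (forall z, x < z < y -> is_derive w z (dw z)) ->
  (forall z, x < z < y -> 0 <= dw z) -> w x <= w y.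
Proof.
  intros wc [H| ->] wd p; [|lra].
  destruct (mean_value w dw x y) as [z [Hz E]]; trivial.
  pose proof (p z Hz); nra.
Qed.

Lemma incr_lim0_le0 (w : R -> R) :
  (forall x y, 0 <= x <= y -> w x <= w y) -> is_lim w p_infty 0 ->
  forall x, 0 <= x -> w x <= 0.
Proof.
  intros incr lim x Hx.
  apply (is_lim_le_loc (fun _ => w x) w p_infty (w x) 0).
  - exists x; intros y Hy; apply incr; lra.
  - apply is_lim_const.
  - exact lim.
Qed.

(** Same reduction as for the profiles, with clamping to [[0,1]]; no limit is available here, so [c]
    remains to be estimated. *)
Lemma viscous_ode (f u : R -> R) (eps u0 u1 : R) :
  0 < eps -> (forall y, ex_derive f y) -> viscous_solution f eps u0 u1 u ->
  exists w c, (forall x, 0 <= x <= 1 -> w x = u x) /\ (forall x, continuous w x) /\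
    forall x, 0 < x < 1 -> is_derive w x ((f (w x) + c) / eps).
Proof.
  intros He Hf [uc [ud [E _]]].
  destruct (first_integral (fun x => 0 < x < 1) f u eps (/ 2)) as [c Hc]; trivial.
  - intros; lra.
  - lra.
  - set (w := fun x => u (Rmax 0 (Rmin 1 x))).
    assert (wu : forall x, 0 <= x <= 1 -> w x = u x).
    { intros x Hx; unfold w; rewrite Rmin_right, Rmax_right; trivial; lra. }
    exists w, c; split; [exact wu|split].
    + apply (continuous_retract (fun x => 0 <= x <= 1) u (fun x => Rmax 0 (Rmin 1 x))); trivial.
      * intros x; split; [apply Rmax_l|].
        apply Rmax_lub; [lra|apply Rmin_l].
      * intros x y; unfold Rmin; destruct (Rle_dec 1 x), (Rle_dec 1 y);
          unfold Rmax; repeat destruct (Rle_dec 0 _);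
          unfold Rabs; repeat destruct Rcase_abs; lra.
    + intros x Hx; rewrite wu, <- Hc by lra.
      replace (eps * Derive u x / eps) with (Derive u x) by (field; lra).
      apply is_derive_ext_loc with u; [|apply Derive_correct; now apply ud].
      assert (d : 0 < Rmin x (1 - x)) by (apply Rmin_glb_lt; lra).
      exists (mkposreal _ d); intros y Hy.
      change (Rabs (y - x) < Rmin x (1 - x)) in Hy; apply Rabs_def2 in Hy.
      pose proof (Rmin_l x (1 - x)); pose proof (Rmin_r x (1 - x)).
      symmetry; apply wu; lra.
Qed.

(** * Assembly of the layer estimate *)

Theorem theorem3p14
  (f : R -> R) (u0 u1 : R) (v0 v1 : R -> R)
  (f_C2 : C2 f) (f_convex : strictly_convex f)
  (f_0 : f 0 = 0) (df_0 : Derive f 0 = 0) (d2f_0 : Derive_n f 2 0 <> 0)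
  (u0_neg : u0 < 0) (u1_pos : 0 < u1)
  (v0_sol : left_layer_profile f u0 v0)
  (v1_sol : right_layer_profile f u1 v1) :
  exists C : R, 0 < C /\
    forall (eps : R) (u : R -> R), 0 < eps <= 1 ->
      viscous_solution f eps u0 u1 u ->
      forall x : R, 0 <= x <= 1 ->
        Rabs (u x - v0 (x / eps) - v1 ((1 - x) / eps)) <= C * eps.
Proof.
  assert (fd : forall y, ex_derive f y) by (intros; now apply (proj1 f_C2)).
  assert (ge0 := flux_ge0 f f_C2 f_convex f_0 df_0).
  destruct v0_sol as [v0c [v0d [v0e [v00 v0l]]]].
  destruct (profile_ode f v0) as [p0 [E0 [p0c [p0d p0l]]]]; trivial.
  destruct v1_sol as [v1c [v1d [v1e [v10 v1l]]]].
  (* The right layer is a left layer for the flux [- f]; its monotonicity and sign are obtained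
     through [- p1]. *)
  destruct (profile_ode (fun y => - f y) v1) as [p1 [E1 [p1c [p1d p1l]]]]; trivial.
  { intros y; apply (ex_derive_opp f), fd. }
  { rewrite f_0; ring. }
  { intros x Hx; rewrite Derive_opp; now apply v1e. }
  assert (p0i : forall x y, 0 <= x <= y -> p0 x <= p0 y).
  { intros x y H; apply (derive_ge0_incr p0 (fun z => f (p0 z))); trivial; try lra.
    intros z Hz; apply p0d; lra. }
  assert (p1i : forall x y, 0 <= x <= y -> - p1 x <= - p1 y).
  { intros x y H.
    apply (derive_ge0_incr (fun z => - p1 z) (fun z => - - f (p1 z))); try lra.
    - intros z; apply (continuous_opp p1), p1c.
    - intros z Hz; apply (is_derive_opp p1), p1d; lra.
    - intros z Hz; pose proof (ge0 (p1 z)); lra. }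
  assert (p0n := incr_lim0_le0 p0 p0i p0l).
  assert (p1n : forall x, 0 <= x -> - p1 x <= 0).
  { apply (incr_lim0_le0 (fun z => - p1 z) p1i).
    replace (Finite 0) with (Rbar_opp 0) by (simpl; f_equal; ring).
    now apply is_lim_opp. }
  (* The solution increases from [u0] to [u1], so this radius contains all its values, whatever
     [eps] is. *)
  destruct (flux_quadratic f f_C2 f_convex f_0 df_0 (Rmax (- u0) u1) d2f_0)
    as [m [mp Hm]].
  { pose proof (Rmax_r (- u0) u1); lra. }
  pose proof (Rmax_l (- u0) u1) as B0; pose proof (Rmax_r (- u0) u1) as B1.
  set (K := PI ^ 2 / m).
  assert (Kp : 0 < K).
  { apply Rdiv_lt_0_compat; [|exact mp]. pose proof PI_RGT_0; nra. }
  (* One [K * eps] pays for the layer on the side of [x], the other for the tail of the opposite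
     layer. *)
  exists (2 * K); split; [lra|].
  intros eps u He sol x Hx.
  destruct (viscous_ode f u eps u0 u1) as [w [c [Ew [wc wd]]]]; trivial; try lra.
  destruct sol as [_ [_ [_ [ua ub]]]].
  rewrite <- Ew in ua, ub by lra.
  destruct (last_zero w 0 1) as [s [Hs [ws wpos]]]; trivial; try lra.
  assert (cp : 0 < c).
  { apply (flux_constant_pos f f_convex f_0 w eps c s); trivial; lra. }
  assert (wi : forall a b, 0 <= a <= b -> b <= 1 -> w a <= w b).
  { intros a b ab b1.
    apply (derive_ge0_incr w (fun z => (f (w z) + c) / eps)); trivial; try lra.
    - intros; apply wd; lra.
    - intros z _; pose proof (ge0 (w z)); apply Rdiv_le_0_compat; lra. }
  assert (ck : c <= K * eps ^ 2).
  { assert (m * c <= PI ^ 2 * eps ^ 2).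
    { apply (flux_constant_le f w); trivial; try lra.
      intros z Hz; apply Hm.
      pose proof (wi 0 z ltac:(lra) ltac:(lra)); pose proof (wi z 1 ltac:(lra) ltac:(lra)).
      apply Rabs_le; lra. }
    unfold K; replace (PI ^ 2 / m * eps ^ 2) with (PI ^ 2 * eps ^ 2 / m) by (field; lra).
    apply Rle_div_r; lra. }
  (* Source [c] of order [eps ^ 2] times a stretched time of at most [1 / eps]. *)
  assert (scale : forall y, 0 <= y <= 1 -> c * (y / eps) <= K * eps).
  { intros y Hy.
    replace (c * (y / eps)) with (c * y / eps) by (field; lra).
    apply Rle_div_l; [lra|]. nra. }
  (* In the variable [z = x / eps], [w] solves the equation of [p0] with added source [c] and the
     same initial value. *)
  assert (left : forall y, 0 <= y <= s -> Rabs (w y - p0 (y / eps)) <= K * eps).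
  { intros y Hy.
    apply Rle_trans with (2 := scale y ltac:(lra)).
    replace (w y) with (w (eps * (y / eps))) by (f_equal; field; lra).
    rewrite <- (Rabs_right c) by lra.
    assert (inside : forall z, 0 < z < y / eps -> 0 < eps * z < s).
    { intros z [z0 zy]; apply Rlt_div_r in zy; [nra|lra]. }
    apply (dissipative_comparison f (fun z => w (eps * z)) p0); trivial.
    - apply Rdiv_le_0_compat; lra.
    - intros z; apply (continuous_comp (fun z => eps * z) w); [|apply wc].
      apply (ex_derive_continuous (fun z => eps * z)); auto_derive; trivial.
    - intros z Hz; pose proof (inside z Hz).
      evar_last.
      + apply (is_derive_comp w (fun z => eps * z) z ((f (w (eps * z)) + c) / eps) eps);
          [apply wd; lra|].
        auto_derive; [trivial|ring].
      + unfold scal; simpl; unfold mult; simpl; field; lra.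
    - intros z Hz; apply p0d; lra.
    - intros z Hz; pose proof (inside z Hz).
      assert (w (eps * z) <= 0) by (rewrite <- ws; apply wi; lra).
      assert (p0 z <= 0) by (apply p0n; lra).
      destruct (Rle_lt_dec (w (eps * z)) (p0 z)) as [L|L].
      + pose proof (flux_decr f f_C2 f_convex f_0 df_0 (w (eps * z)) (p0 z) ltac:(lra)); nra.
      + pose proof (flux_decr f f_C2 f_convex f_0 df_0 (p0 z) (w (eps * z)) ltac:(lra)); nra.
    - rewrite Rmult_0_r, ua, E0; [now symmetry|lra]. }
  assert (right : forall y, s <= y <= 1 -> Rabs (w y - p1 ((1 - y) / eps)) <= K * eps).
  { intros y Hy.
    apply Rle_trans with (2 := scale (1 - y) ltac:(lra)).
    replace (w y) with (w (1 - eps * ((1 - y) / eps))) by (f_equal; field; lra).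
    (* Reversing the direction of [x] changes the sign of the source, so the comparison is applied
       with [k = - c]. On this side both functions are nonnegative, where [- f] decreases. *)
    rewrite <- (Rabs_right c), <- (Rabs_Ropp c) by lra.
    assert (inside : forall z, 0 < z < (1 - y) / eps -> s < 1 - eps * z < 1).
    { intros z [z0 zy]; apply Rlt_div_r in zy; [nra|lra]. }
    apply (dissipative_comparison (fun y => - f y) (fun z => w (1 - eps * z)) p1); trivial.
    - apply Rdiv_le_0_compat; lra.
    - intros z; apply (continuous_comp (fun z => 1 - eps * z) w); [|apply wc].
      apply (ex_derive_continuous (fun z => 1 - eps * z)); auto_derive; trivial.
    - intros z Hz; pose proof (inside z Hz).
      evar_last.
      + apply (is_derive_comp w (fun z => 1 - eps * z) z
          ((f (w (1 - eps * z)) + c) / eps) (- eps)); [apply wd; lra|].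
        auto_derive; [trivial|ring].
      + unfold scal; simpl; unfold mult; simpl; field; lra.
    - intros z Hz; apply p1d; lra.
    - intros z Hz; pose proof (inside z Hz).
      assert (0 <= w (1 - eps * z)) by (rewrite <- ws; apply wi; lra).
      assert (- p1 z <= 0) by (apply p1n; lra).
      destruct (Rle_lt_dec (w (1 - eps * z)) (p1 z)) as [L|L].
      + pose proof (flux_incr f f_C2 f_convex f_0 df_0 (w (1 - eps * z)) (p1 z) ltac:(lra)); nra.
      + pose proof (flux_incr f f_C2 f_convex f_0 df_0 (p1 z) (w (1 - eps * z)) ltac:(lra)); nra.
    - rewrite Rmult_0_r, Rminus_0_r, ub, E1; [now symmetry|lra]. }
  assert (quot : forall a b, 0 <= a <= b -> 0 <= a / eps <= b / eps).
  { intros a b ab; split; [apply Rdiv_le_0_compat; lra|].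
    apply Rmult_le_compat_r; [|lra].
    left; apply Rinv_0_lt_compat; lra. }
  rewrite <- Ew, <- E0, <- E1 by (trivial; apply Rdiv_le_0_compat; lra).
  (* Since [w s = 0], these two estimates bound the layers themselves at [s] by [K * eps]. *)
  assert (Ls := left s ltac:(lra)); assert (Rs := right s ltac:(lra)).
  rewrite ws in Ls, Rs; apply Rabs_le_between in Ls; apply Rabs_le_between in Rs.
  apply Rabs_le_between.
  (* Left of [s], the right layer is farther from its boundary point than at [s], so it lies between
     0 and [K * eps]; the other case is symmetric. *)
  destruct (Rle_lt_dec x s) as [xs|xs].
  - assert (L := left x ltac:(lra)); apply Rabs_le_between in L.
    assert (q := quot (1 - s) (1 - x) ltac:(lra)).
    pose proof (p1i _ _ q); pose proof (p1n ((1 - x) / eps) ltac:(lra)); lra.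
  - assert (L := right x ltac:(lra)); apply Rabs_le_between in L.
    assert (q := quot s x ltac:(lra)).
    pose proof (p0i _ _ q); pose proof (p0n (x / eps) ltac:(lra)); lra.
Qed.
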